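(* Let $m>1$, $\mathbf{A}=(a_{ij})\in\mathbb{H}^{m\times m}$, and $k\in\{1,\dots,48\}$. Let $\mathcal{S}$ be the set of square submatrices of $\mathbf{A}$ of order $m-1$, let $\mathbf{B}'\in\mathcal{S}$ be such that $\mathrm{Rank}(\mathcal{P}_1(\mathbf{B}'))=\max\{\mathrm{Rank}(\mathcal{P}_1(\mathbf{B})):\mathbf{B}\in\mathcal{S}\}$, and let $\mathbf{C}_1,\dots,\mathbf{C}_{16}$ be the sixteen submatrices of order $4m-3$ of $\mathcal{P}_1(\mathbf{A})$ associated with $\mathbf{B}'$ (defined in the context). Then the following statements are equivalent: (1) $\det\mathcal{P}_k(\mathbf{A})=0$. (2) There exist $t_1\in\{1,2,3,4\}$, $t_2\in\{5,6,7,8\}$, $t_3\in\{9,10,11,12\}$ and $t_4\in\{13,14,15,16\}$ such that $\det\mathbf{C}_{t_1}=\det\mathbf{C}_{t_2}=\det\mathbf{C}_{t_3}=\det\mathbf{C}_{t_4}=0$. (3) For all $t_1\in\{1,2,3,4\}$, $t_2\in\{5,6,7,8\}$, $t_3\in\{9,10,11,12\}$ and $t_4\in\{13,14,15,16\}$, $\det\mathbf{C}_{t_1}=\det\mathbf{C}_{t_2}=\det\mathbf{C}_{t_3}=\det\mathbf{C}_{t_4}=0$.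
   Context: $\mathbb{H}$ denotes the quaternions; $q\in\mathbb{H}$ is written $q=[q]_0+[q]_1\hbar+[q]_2\jmath+[q]_3\kappa$ with real coefficients and $\hbar^2=\jmath^2=\kappa^2=\hbar\jmath\kappa=-1$. Let $\mathbf{E}$ be the $4\times4$ identity matrix. Let $(\mathbf{H}_k,\mathbf{J}_k,\mathbf{K}_k)$, $k=1,\dots,48$, be an enumeration of the 48 ordered triples of $4\times4$ signed permutation matrices satisfying the Hamiltonian conditions $\mathbf{H}_k^2=\mathbf{J}_k^2=\mathbf{K}_k^2=\mathbf{H}_k\mathbf{J}_k\mathbf{K}_k=-\mathbf{E}$, where the triple with $k=1$ is $$\mathbf{H}_1=\begin{pmatrix}0&-1&0&0\\1&0&0&0\\0&0&0&-1\\0&0&1&0\end{pmatrix},\quad \mathbf{J}_1=\begin{pmatrix}0&0&-1&0\\0&0&0&1\\1&0&0&0\\0&-1&0&0\end{pmatrix},\quad \mathbf{K}_1=\begin{pmatrix}0&0&0&-1\\0&0&-1&0\\0&1&0&0\\1&0&0&0\end{pmatrix}.$$ Define $\mathcal{Q}_k(q)=[q]_0\mathbf{E}+[q]_1\mathbf{H}_k+[q]_2\mathbf{J}_k+[q]_3\mathbf{K}_k\in\mathbb{R}^{4\times4}$, and for $\mathbf{A}=(a_{ij})\in\mathbb{H}^{m\times n}$ let $\mathcal{P}_k(\mathbf{A})=(\mathcal{Q}_k(a_{ij}))\in\mathbb{R}^{4m\times4n}$ (block matrix). Definition of $\mathbf{C}_t$: suppose $\mathbf{B}'$ is obtained from $\mathbf{A}$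 by deleting row $i$ and column $j$. For $r,c\in\{1,2,3,4\}$ let $\mathbf{M}(r,c)$ be the submatrix of $\mathcal{P}_1(\mathbf{A})$ of order $4m-3$ whose rows are row $4(i-1)+r$ together with all rows not in $\{4(i-1)+1,\dots,4i\}$, and whose columns are column $4(j-1)+c$ together with all columns not in $\{4(j-1)+1,\dots,4j\}$ (rows and columns in their natural increasing order); it contains $\mathcal{P}_1(\mathbf{B}')$ as a submatrix. Then $\mathbf{C}_1=\mathbf{M}(1,1)$, $\mathbf{C}_2=\mathbf{M}(2,2)$, $\mathbf{C}_3=\mathbf{M}(3,3)$, $\mathbf{C}_4=\mathbf{M}(4,4)$, $\mathbf{C}_5=\mathbf{M}(1,2)$, $\mathbf{C}_6=\mathbf{M}(2,1)$, $\mathbf{C}_7=\mathbf{M}(3,4)$, $\mathbf{C}_8=\mathbf{M}(4,3)$, $\mathbf{C}_9=\mathbf{M}(1,3)$, $\mathbf{C}_{10}=\mathbf{M}(2,4)$, $\mathbf{C}_{11}=\mathbf{M}(3,1)$, $\mathbf{C}_{12}=\mathbf{M}(4,2)$, $\mathbf{C}_{13}=\mathbf{M}(1,4)$, $\mathbf{C}_{14}=\mathbf{M}(2,3)$, $\mathbf{C}_{15}=\mathbf{M}(3,2)$, $\mathbf{C}_{16}=\mathbf{M}(4,1)$. *)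

(* Defs.v *)
From HB Require Import structures.
From mathcomp Require Import all_boot all_order all_algebra all_fingroup.
From mathcomp Require Import ring.
From mathcomp Require Export reals.

Set Implicit Arguments.
Unset Strict Implicit.
Unset Printing Implicit Defensive.

Import GRing.Theory.
Local Open Scope ring_scope.

(* Hamilton quaternions q0 + q1 i + q2 j + q3 k over a commutative ring. *)
Record quaternion (R : Type) := Quaternion { q0 : R; q1 : R; q2 : R; q3 : R }.

Definition quat_tuple (R : Type) (q : quaternion R) := (q0 q, q1 q, q2 q, q3 q).
Definition tuple_quat (R : Type) (x : R * R * R * R) :=
  let: (a, b, c, d) := x in Quaternion a b c d.
Lemma quat_tupleK (R : Type) : cancel (@quat_tuple R) (@tuple_quat R).
Proof. by case. Qed.

HB.instance Definition _ (R : eqType) :=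
  Equality.copy (quaternion R) (can_type (@quat_tupleK R)).
HB.instance Definition _ (R : choiceType) :=
  Choice.copy (quaternion R) (can_type (@quat_tupleK R)).

Section QuaternionRing.
Variable R : comNzRingType.
Implicit Types x y z : quaternion R.

Definition addq x y :=
  Quaternion (q0 x + q0 y) (q1 x + q1 y) (q2 x + q2 y) (q3 x + q3 y).
Definition oppq x := Quaternion (- q0 x) (- q1 x) (- q2 x) (- q3 x).
Definition mulq x y := Quaternion
  (q0 x * q0 y - q1 x * q1 y - q2 x * q2 y - q3 x * q3 y)
  (q0 x * q1 y + q1 x * q0 y + q2 x * q3 y - q3 x * q2 y)
  (q0 x * q2 y - q1 x * q3 y + q2 x * q0 y + q3 x * q1 y)
  (q0 x * q3 y + q1 x * q2 y - q2 x * q1 y + q3 x * q0 y).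

Fact addqA : associative addq.
Proof. by move=> x y z; congr Quaternion; rewrite /= addrA. Qed.
Fact addqC : commutative addq.
Proof. by move=> x y; congr Quaternion; rewrite addrC. Qed.
Fact add0q : left_id (Quaternion 0 0 0 0) addq.
Proof. by case=> *; congr Quaternion; rewrite /= add0r. Qed.
Fact addNq : left_inverse (Quaternion 0 0 0 0) oppq addq.
Proof. by move=> x; congr Quaternion; rewrite /= addNr. Qed.

HB.instance Definition _ :=
  GRing.isZmodule.Build (quaternion R) addqA addqC add0q addNq.

Fact mulqA : associative mulq.
Proof. by move=> x y z; congr Quaternion; rewrite /=; ring. Qed.
Fact mul1q : left_id (Quaternion 1 0 0 0) mulq.
Proof. by case=> *; congr Quaternion; rewrite /=; ring. Qed.
Fact mulq1 : right_id (Quaternion 1 0 0 0) mulq.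
Proof. by case=> *; congr Quaternion; rewrite /=; ring. Qed.
Fact mulqDl : left_distributive mulq addq.
Proof. by move=> x y z; congr Quaternion; rewrite /=; ring. Qed.
Fact mulqDr : right_distributive mulq addq.
Proof. by move=> x y z; congr Quaternion; rewrite /=; ring. Qed.
Fact oneq_neq0 : Quaternion 1 0 0 0 != 0 :> quaternion R.
Proof. by apply/eqP=> -[] /eqP; rewrite oner_eq0. Qed.

HB.instance Definition _ := GRing.Zmodule_isNzRing.Build (quaternion R)
  mulqA mul1q mulq1 mulqDl mulqDr oneq_neq0.

Lemma quaternion_units (h := Quaternion 0 1 0 0 : quaternion R)
    (j := Quaternion 0 0 1 0) (k := Quaternion 0 0 0 1) :
  [/\ h * h = -1, j * j = -1, k * k = -1 & h * j * k = -1].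
Proof. by split; congr Quaternion => /=; ring. Qed.

End QuaternionRing.

Section Representations.
Variable R : realType.

Record triple := Triple { tH : 'M[R]_4; tJ : 'M[R]_4; tK : 'M[R]_4 }.

Definition signed_perm_mx n (M : 'M[R]_n) : Prop :=
  exists (s : 'S_n) (e : 'I_n -> bool),
    M = diag_mx (\row_i (-1) ^+ e i) *m perm_mx s.

Definition hamiltonian_triple (T : triple) : Prop :=
  [/\ signed_perm_mx (tH T), signed_perm_mx (tJ T) & signed_perm_mx (tK T)] /\
  [/\ tH T *m tH T = - 1%:M, tJ T *m tJ T = - 1%:M, tK T *m tK T = - 1%:M
    & tH T *m tJ T *m tK T = - 1%:M].

Definition mx4_of_seq (s : seq (seq R)) : 'M[R]_4 :=
  \matrix_(i < 4, j < 4) nth 0 (nth [::] s i) j.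

Definition triple1 : triple := Triple
  (mx4_of_seq [:: [:: 0; -1; 0;  0];
                  [:: 1;  0; 0;  0];
                  [:: 0;  0; 0; -1];
                  [:: 0;  0; 1;  0]])
  (mx4_of_seq [:: [:: 0;  0; -1; 0];
                  [:: 0;  0;  0; 1];
                  [:: 1;  0;  0; 0];
                  [:: 0; -1;  0; 0]])
  (mx4_of_seq [:: [:: 0; 0;  0; -1];
                  [:: 0; 0; -1;  0];
                  [:: 0; 1;  0;  0];
                  [:: 1; 0;  0;  0]]).

(* The index k = 1, ..., 48 is represented by k - 1 : 'I_48. *)
Definition hamiltonian_enumeration (T : 'I_48 -> triple) : Prop :=
  [/\ injective T,
      forall t : triple, hamiltonian_triple t <-> exists k, T k = t
    & T ord0 = triple1].

Definition Qmx (T : triple) (q : quaternion R) : 'M[R]_4 :=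
  q0 q *: 1%:M + q1 q *: tH T + q2 q *: tJ T + q3 q *: tK T.

Definition Pmx (T : triple) m n (A : 'M[quaternion R]_(m, n)) :
    'M[R]_(\sum_(i < m) 4, \sum_(j < n) 4) :=
  \mxblock_(i < m, j < n) Qmx T (A i j).

End Representations.

(* [tagnat.Rank i r] is the position of the r-th row (or column) of the i-th
   block; with 0-based indices it has value 4 i + r. *)
Definition kept m (i : 'I_m) (r : 'I_4) : {set 'I_(\sum_(i < m) 4)} :=
  tagnat.Rank i r |: [set u | tagnat.sig1 u != i].

Lemma card_kept m (i : 'I_m) (r : 'I_4) : #|kept i r| = (4 * m - 3)%N.
Proof.
have RI : injective (@tagnat.Rank m (fun=> 4) i).
  move=> s t /(congr1 val)/eqP; rewrite tagnat.eq_Rank eqxx /=.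
  by move=> /eqP/val_inj.
have -> : kept i r = ~: [set tagnat.Rank i s | s in [set~ r]].
  apply/setP => u; rewrite !inE -[u]tagnat.sig2K tagnat.Rank1K.
  move: (tagnat.sig1 u) (tagnat.sig2 u) => i' s.
  have [ei|ni] := eqVneq i' i; last first.
    rewrite orbT; apply/esym/imsetP => -[t _] /(congr1 tagnat.sig1).
    by rewrite !tagnat.Rank1K => /eqP; rewrite (negPf ni).
  rewrite {}ei in s *; rewrite orbF (inj_eq RI) mem_imset // !inE.
  by rewrite negbK.
rewrite cardsCs setCK card_imset // card_ord cardsC1 card_ord.
by rewrite sum_nat_const card_ord mulnC.
Qed.

(* [enum_val] lists a set of ordinals in increasing order. *)
Definition kept_index m (i : 'I_m) (r : 'I_4) (u : 'I_(4 * m - 3)) :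
    'I_(\sum_(i < m) 4) :=
  enum_val (cast_ord (esym (card_kept i r)) u).

(* The positions (r, c) of the matrices M(r, c) = C_1, ..., C_16; 1-based as
   in the names C_t, so that 1-based r is the ordinal r - 1 : 'I_4. *)
Definition Cpos : seq (nat * nat) :=
  [:: (1, 1); (2, 2); (3, 3); (4, 4);
      (1, 2); (2, 1); (3, 4); (4, 3);
      (1, 3); (2, 4); (3, 1); (4, 2);
      (1, 4); (2, 3); (3, 2); (4, 1)]%N.

Section Submatrices.
Variables (R : realType) (m : nat) (A : 'M[quaternion R]_m) (i j : 'I_m).

Definition delete_row_col : 'M[quaternion R]_m.-1 := row' i (col' j A).

Definition bordered (r c : 'I_4) : 'M[R]_(4 * m - 3) :=
  mxsub (kept_index i r) (kept_index j c) (Pmx (triple1 R) A).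

(* Only meant for 1 <= t <= 16. *)
Definition Cmx (t : nat) : 'M[R]_(4 * m - 3) :=
  let: (r, c) := nth (1, 1)%N Cpos t.-1 in
  bordered (inord r.-1) (inord c.-1).

End Submatrices.

(* Main.v *)
Require Import Defs.
From mathcomp Require Import all_boot all_order all_algebra.
From mathcomp Require Import ring zify.

Set Implicit Arguments.
Unset Strict Implicit.
Unset Printing Implicit Defensive.

Import Order.TTheory GRing.Theory Num.Theory.
Local Open Scope ring_scope.

(* The matrices [Qmx triple1 q] describe left multiplication by [q] on the
   quaternions, so [Pmx triple1 A] is singular iff [A *m x = 0] for some nonzero
   quaternionic column [x]; every other Hamiltonian triple is similar to
   [triple1]. Likewise [det M(r, c) = 0] iff some nonzero [x] has its [j]-th
   entry real proportional to the [c]-th unit [u_c] and [A *m x] vanishing outside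
   the [i]-th entry, whose [r]-th coordinate is zero as well. If [A y = 0] with
   [y <> 0], then [x = y y_j^-1 u_c] (or [y] itself if [y_j = 0]) shows that all
   the [C_t] are singular. Conversely, if [A] is regular then so is some minor,
   hence [B'] by maximality of its rank; then, up to right scaling, all these
   [x] equal the [y] normalised by [y_j = 1], and [det C_t = 0] kills one
   coordinate of [(A y)_i], the same one for each [t] in a group of four. All
   four groups together give [A y = 0], a contradiction. *)

(** * Quaternion inverses and real coordinates *)

Section Quaternions.
Variable R : realType.
Implicit Types q x y : quaternion R.

Lemma quatP x y :
  q0 x = q0 y -> q1 x = q1 y -> q2 x = q2 y -> q3 x = q3 y -> x = y.
Proof. by case: x y => [? ? ? ?] [? ? ? ?] /= -> -> -> ->. Qed.

Lemma quat1E : 1 = Quaternion 1 0 0 0 :> quaternion R. Proof. by []. Qed.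
Lemma quatME x y : x * y = Defs.mulq x y. Proof. by []. Qed.

Definition quat_norm q := q0 q ^+ 2 + q1 q ^+ 2 + q2 q ^+ 2 + q3 q ^+ 2.
Definition quat_inv q := Quaternion (q0 q / quat_norm q) (- q1 q / quat_norm q)
  (- q2 q / quat_norm q) (- q3 q / quat_norm q).

Lemma quat_norm_eq0 q : (quat_norm q == 0) = (q == 0).
Proof.
rewrite /quat_norm !paddr_eq0 ?addr_ge0 ?sqr_ge0 // !sqrf_eq0 -!andbA.
apply/and4P/eqP => [[/eqP a /eqP b /eqP c /eqP d]|->]; last by split.
exact: quatP.
Qed.

Lemma mulVq q : q != 0 -> quat_inv q * q = 1.
Proof.
rewrite -quat_norm_eq0 quatME quat1E /quat_inv => n0.
by apply: quatP => /=; move: n0; rewrite /quat_norm => n0; field.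
Qed.

Lemma mulqV q : q != 0 -> q * quat_inv q = 1.
Proof.
rewrite -quat_norm_eq0 quatME quat1E /quat_inv => n0.
by apply: quatP => /=; move: n0; rewrite /quat_norm => n0; field.
Qed.

(* Zero for [n > 3]. *)
Definition coordq q (n : nat) := nth 0 [:: q0 q; q1 q; q2 q; q3 q] n.

Definition quat_of (f : nat -> R) := Quaternion (f 0%N) (f 1%N) (f 2%N) (f 3%N).

Lemma coordq_of f (r : 'I_4) : coordq (quat_of f) r = f r.
Proof. by case: r => [[|[|[|[|]]]]]. Qed.

Lemma coordqP x y : (forall r : 'I_4, coordq x r = coordq y r) -> x = y.
Proof.
move=> e; apply: quatP.
- exact: (e (@Ordinal 4 0 isT)).
- exact: (e (@Ordinal 4 1 isT)).
- exact: (e (@Ordinal 4 2 isT)).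
- exact: (e (@Ordinal 4 3 isT)).
Qed.

Lemma coordq0 n : coordq 0 n = 0.
Proof. by case: n => [|[|[|[|n]]]] //; rewrite /coordq /= nth_nil. Qed.

Lemma coordqD x y n : coordq (x + y) n = coordq x n + coordq y n.
Proof.
by case: n => [|[|[|[|n]]]] //; rewrite /coordq /= !nth_nil addr0.
Qed.

Definition colq q : 'cV[R]_4 := \col_r coordq q r.

Lemma colq_surj (v : 'cV[R]_4) : exists q, v = colq q.
Proof.
exists (quat_of (fun n => v (inord n) 0)).
by apply/matrixP=> r s; rewrite mxE coordq_of inord_val (ord1 s).
Qed.

Lemma colqD x y : colq (x + y) = colq x + colq y.
Proof. by apply/matrixP=> r s; rewrite !mxE coordqD. Qed.

Lemma colq0 : colq 0 = 0.
Proof. by apply/matrixP=> r s; rewrite !mxE coordq0. Qed.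

Lemma Qmx1_colq q x : Qmx (triple1 R) q *m colq x = colq (q * x).
Proof.
apply/matrixP=> r s; rewrite !mxE !big_ord_recl big_ord0 !mxE quatME.
by case: r => [[|[|[|[|]]]]] //= ?; rewrite /coordq /=; ring.
Qed.

End Quaternions.

(** * Representations attached to Hamiltonian triples *)

Section Hamiltonian.
Variables (R : realType) (T : triple R).
Hypothesis hT : hamiltonian_triple T.

(** The four defining relations force the whole multiplication table of the units: multiply by one
    unit and cancel. The table is what makes [Qmx T] multiplicative. *)
Lemma hamiltonian_mul :
  [/\ tH T *m tJ T = tK T, tJ T *m tK T = tH T & tK T *m tH T = tJ T] /\
  [/\ tJ T *m tH T = - tK T, tK T *m tJ T = - tH T & tH T *m tK T = - tJ T].
Proof.
case: hT => _ [HH JJ KK HJK].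
have HJ : tH T *m tJ T = tK T.
  apply: oppr_inj; have := congr1 (mulmx^~ (tK T)) HJK.
  by rewrite -mulmxA KK mulmxN mulNmx mulmx1 mul1mx.
have JK : tJ T *m tK T = tH T.
  apply: oppr_inj; have := congr1 (mulmx (tH T)) HJK.
  by rewrite !mulmxA HH mulmxN !mulNmx mulmx1 mul1mx.
have JH : tJ T *m tH T = - tK T.
  by rewrite -JK mulmxA JJ mulNmx mul1mx.
have KJ : tK T *m tJ T = - tH T.
  by rewrite -HJ -mulmxA JJ mulmxN mulmx1.
have HK : tH T *m tK T = - tJ T.
  by rewrite -HJ mulmxA HH mulNmx mul1mx.
have KH : tK T *m tH T = tJ T.
  by rewrite -HJ -mulmxA JH mulmxN HK opprK.
by [].
Qed.

Lemma QmxM x y : Qmx T (x * y) = Qmx T x *m Qmx T y.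
Proof.
case: hT => _ [HH JJ KK _]; case: hamiltonian_mul => -[HJ JK KH] [JH KJ HK].
rewrite /Qmx quatME !(mulmxDl, mulmxDr) -!(scalemxAl, scalemxAr).
rewrite !mul1mx !mulmx1 HH JJ KK HJ JK KH JH KJ HK.
by apply/matrixP=> r s; rewrite !mxE /=; ring.
Qed.

Lemma Qmx1E : Qmx T 1 = 1%:M.
Proof. by rewrite /Qmx /= !scale0r !addr0 scale1r. Qed.

(* With [e] the first unit vector, the columns are [e], [H e], [J e], [K e]:
   this carries left multiplication on the quaternions, which [triple1]
   encodes, to the action of [T]. *)
Definition intertwiner : 'M[R]_4 := \matrix_(r, s)
  nth 0 [:: (1%:M : 'M_4); tH T; tJ T; tK T] s r 0.

Lemma intertwiner_colq x : intertwiner *m colq x = col 0 (Qmx T x).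
Proof.
apply/matrixP=> r s; rewrite !mxE !big_ord_recl big_ord0 !mxE /=.
rewrite /coordq /=; ring.
Qed.

Lemma eq_mul_colq (M N : 'M[R]_4) :
  (forall x, M *m colq x = N *m colq x) -> M = N.
Proof.
move=> e; apply/trmx_inj/row_matrixP => s.
rewrite !rowE; apply: trmx_inj; rewrite !trmx_mul !trmxK.
have [x ->] := colq_surj (delta_mx 0 s : 'rV[R]_4)^T; exact: e.
Qed.

(** Applied to [colq x], both sides become the first column of [Qmx T (q * x)]. *)
Lemma Qmx_intertwiner q :
  Qmx T q *m intertwiner = intertwiner *m Qmx (triple1 R) q.
Proof.
apply: eq_mul_colq => x;
rewrite -!mulmxA Qmx1_colq !intertwiner_colq (QmxM q x).
by rewrite !colE mulmxA.
Qed.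

End Hamiltonian.

(** * Kernels of matrices and of their submatrices *)

Lemma det0_colP (F : fieldType) n (M : 'M[F]_n) :
  \det M = 0 <-> exists2 x : 'cV[F]_n, x != 0 & M *m x = 0.
Proof.
rewrite -det_tr; split=> [/eqP/det0P[v v0 vM]|[x x0 Mx]].
  by exists v^T; rewrite ?trmx_eq0 //; apply: trmx_inj;
    rewrite trmx_mul trmxK trmx0.
apply/eqP/det0P; exists x^T; first by rewrite trmx_eq0.
by rewrite -trmx_mul Mx trmx0.
Qed.

(** The discarded columns of [M] meet only zero entries of [x], and injectivity of [g] keeps any
    column from being counted twice. *)
Lemma mxsub_mul_supported (F : pzRingType) n N (M : 'M[F]_N)
    (f g : 'I_n -> 'I_N) (x : 'cV[F]_N) :
    injective g -> (forall v, v \notin codom g -> x v 0 = 0) ->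
  mxsub f g M *m rowsub g x = rowsub f (M *m x).
Proof.
move=> gI xg; apply/matrixP => u k; rewrite !mxE (ord1 k).
under eq_bigr do rewrite !mxE.
rewrite [RHS](bigID (mem (g @: setT))) /= [X in _ + X]big1 ?addr0.
  by rewrite big_imset; [apply: eq_bigl => v; rewrite inE | move=> ? ? _ _ /gI].
move=> v vg; rewrite xg ?mulr0 //; apply: contraNN vg => /codomP[w ->].
exact: imset_f.
Qed.

Lemma det_mxsub_eq0 (F : fieldType) n N (M : 'M[F]_N) (f g : 'I_n -> 'I_N) :
  injective g ->
  \det (mxsub f g M) = 0 <->
  exists x : 'cV[F]_N, [/\ x != 0, forall v, v \notin codom g -> x v 0 = 0
    & forall u, (M *m x) (f u) 0 = 0].
Proof.
move=> gI; rewrite det0_colP; split=> [[z z0 Mz]|[x [x0 xg Mx]]].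
  (* Extension of [z] by zero outside the range of [g]; injectivity makes the picked index
     unique. *)
  pose x : 'cV[F]_N :=
    \col_v if [pick u | g u == v] is Some u then z u 0 else 0.
  have gx : rowsub g x = z.
    apply/matrixP => u k; rewrite (ord1 k) !mxE.
    by case: pickP => [u' /eqP/gI-> //|/(_ u)]; rewrite eqxx.
  have xg v : v \notin codom g -> x v 0 = 0.
    move=> vg; rewrite mxE; case: pickP => // u /eqP uv.
    by rewrite -uv codom_f in vg.
  exists x; split=> // [|u].
    by apply: contraNneq z0 => x0;
    rewrite -gx x0 -[rowsub g 0]/(mxsub g id 0) linear0.
  have /matrixP/(_ u 0) := mxsub_mul_supported M f gI xg.
  by rewrite gx Mz !mxE => <-.
exists (rowsub g x).
  apply: contraNneq x0 => gx; apply/eqP/matrixP => v k; rewrite (ord1 k) mxE.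
  have [/codomP[u ->]|/xg//] := boolP (v \in codom g).
  by have /matrixP/(_ u 0) := gx; rewrite !mxE.
rewrite mxsub_mul_supported //; apply/matrixP => u k.
by rewrite (ord1 k) mxE Mx !mxE.
Qed.

(** * Quaternionic columns as real vectors *)

Section Vectors.
Variable R : realType.

Definition vecq n (x : 'cV[quaternion R]_n) : 'cV[R]_(\sum_(i < n) 4) :=
  \mxcol_(i < n) colq (x i 0).

Lemma vecqE n (x : 'cV[quaternion R]_n) u :
  vecq x u 0 = coordq (x (tagnat.sig1 u) 0) (tagnat.sig2 u).
Proof. by rewrite !mxE. Qed.

Lemma vecq_Rank n (x : 'cV[quaternion R]_n) i (r : 'I_4) :
  vecq x (tagnat.Rank i r) 0 = coordq (x i 0) r.
Proof. by rewrite vecqE tagnat.Rank2K /= tagnat.Rank1K. Qed.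

Lemma vecq_surj n (v : 'cV[R]_(\sum_(i < n) 4)) : exists x, v = vecq x.
Proof.
exists (\col_i quat_of (fun r => v (tagnat.Rank i (inord r : 'I_4)) 0)).
apply/matrixP=> u k; rewrite (ord1 k) vecqE mxE coordq_of inord_val.
by rewrite tagnat.sig2K.
Qed.

Lemma vecq_inj n : injective (@vecq n).
Proof.
move=> x y xy; apply/matrixP=> i k; rewrite (ord1 k); apply: coordqP => r.
by rewrite -!vecq_Rank xy.
Qed.

Lemma vecq_eq0 n (x : 'cV[quaternion R]_n) : (vecq x == 0) = (x == 0).
Proof.
rewrite -(inj_eq (@vecq_inj n)); congr (_ == _).
by apply/matrixP=> u k; rewrite (ord1 k) vecqE !mxE coordq0.
Qed.

Lemma Pmx1_vecq m n (A : 'M[quaternion R]_(m, n)) x :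
  Pmx (triple1 R) A *m vecq x = vecq (A *m x).
Proof.
rewrite /Pmx /vecq mul_mxblock_mxrow; apply: eq_mxcol => i.
under eq_bigr do rewrite Qmx1_colq.
by rewrite mxE (big_morph _ (@colqD R) (colq0 R)).
Qed.

Lemma det_Pmx1_eq0 n (A : 'M[quaternion R]_n) :
  \det (Pmx (triple1 R) A) = 0 <-> exists2 x : 'cV_n, x != 0 & A *m x = 0.
Proof.
rewrite det0_colP; split=> [[v]|[x x0 Ax]].
  have [x ->] := vecq_surj v; rewrite vecq_eq0 Pmx1_vecq => x0 /eqP.
  by rewrite vecq_eq0 => /eqP Ax; exists x.
exists (vecq x); rewrite ?vecq_eq0 // Pmx1_vecq.
by apply/eqP; rewrite vecq_eq0 Ax.
Qed.

(** Links the real rank, in which maximality of [B'] is expressed, to the triviality of a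
    quaternionic kernel. *)
Lemma rank_Pmx1_full n (A : 'M[quaternion R]_n) :
  (\rank (Pmx (triple1 R) A) = \sum_(i < n) 4)%N <->
  forall x : 'cV_n, A *m x = 0 -> x = 0.
Proof.
split=> [rA x Ax|kerA].
  apply/eqP; rewrite -vecq_eq0; apply/eqP.
  have : row_full (Pmx (triple1 R) A) by rewrite /row_full rA.
  move=> /row_full_inj; apply; rewrite mulmx0 Pmx1_vecq.
  by apply/eqP; rewrite vecq_eq0 Ax.
apply: mxrank_unit; rewrite unitmxE unitfE; apply/eqP => /det_Pmx1_eq0[x].
by move=> /eqP x0 /kerA.
Qed.

End Vectors.

(** * Independence of singularity from the Hamiltonian triple *)

Section Singular.
Variables (R : realType) (T : triple R).
Hypothesis hT : hamiltonian_triple T.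

Lemma intertwiner_unit : intertwiner T \in unitmx.
Proof.
rewrite unitmxE unitfE; apply/eqP => /det0_colP[v]; have [x ->] := colq_surj v.
have [->|x0] := eqVneq x 0; first by rewrite colq0 eqxx.
(* The first column of [Qmx T x] would be zero; multiplying by the matrix of the inverse of [x]
   turns it into the first column of the identity. *)
rewrite intertwiner_colq => _ /(congr1 (mulmx (Qmx T (quat_inv x)))).
rewrite mulmx0 colE mulmxA -(QmxM hT) mulVq // Qmx1E mul1mx.
by move=> /matrixP/(_ 0 0)/eqP; rewrite !mxE eqxx oner_eq0.
Qed.

(** Repeating the intertwiner down the diagonal gives an invertible [S] that conjugates one block
    matrix into the other. *)
Lemma det_Pmx_eq0 n (A : 'M[quaternion R]_n) :
  \det (Pmx T A) = 0 <-> \det (Pmx (triple1 R) A) = 0.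
Proof.
pose S := \mxdiag_(i < n) intertwiner T.
have SU : \det S != 0.
  rewrite -unitfE -unitmxE.
  suff /mulmx1_unit[] : S *m \mxdiag_(i < n) invmx (intertwiner T) = 1%:M by [].
  rewrite -mxdiagZ mul_mxdiag_mxblock; apply: eq_mxblock => i j.
  case: eqVneq => ij; last by rewrite mulmx0.
  subst j.
  by rewrite !conform_mx_id mulmxV // intertwiner_unit.
have e : Pmx T A *m S = S *m Pmx (triple1 R) A.
  rewrite mul_mxblock_mxdiag mul_mxdiag_mxblock; apply: eq_mxblock => i j.
  exact: Qmx_intertwiner.
have /eqP := congr1 determinant e; rewrite !det_mulmx [eqbRHS]mulrC => /eqP.
by move/(mulIf SU) ->.
Qed.
End Singular.

(** * Singular bordered submatrices *)

Section Bordered.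
Variable R : realType.

Lemma kept_index_inj m (i : 'I_m) r : injective (kept_index i r).
Proof. by move=> u v /enum_val_inj/cast_ord_inj. Qed.

Lemma codom_kept_index m (i : 'I_m) r u :
  (u \in codom (kept_index i r)) = (u \in kept i r).
Proof.
apply/codomP/idP => [[v ->]|ku]; first exact: enum_valP.
exists (cast_ord (card_kept i r) (enum_rank_in ku u)).
by rewrite /kept_index cast_ordK enum_rankK_in.
Qed.

Lemma Rank_kept m (i k : 'I_m) (r s : 'I_4) :
  (tagnat.Rank k s \in kept i r) = (k != i) || (s == r).
Proof.
rewrite !inE tagnat.Rank1K orbC; have [->|//] := eqVneq k i.
by rewrite -(inj_eq val_inj) [LHS]/= tagnat.eq_Rank eqxx /=.
Qed.

(** Column block [j] keeps only column [c], so the support condition leaves [x j 0] a single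
    coordinate; row block [i] keeps only row [r], so a single coordinate of [(A *m x) i 0] is
    tested. *)
Lemma det_bordered_eq0 m (A : 'M[quaternion R]_m) (i j : 'I_m) (r c : 'I_4) :
  \det (bordered A i j r c) = 0 <->
  exists x : 'cV_m, [/\ x != 0, forall s : 'I_4, s != c -> coordq (x j 0) s = 0,
    forall l, l != i -> (A *m x) l 0 = 0 & coordq ((A *m x) i 0) r = 0].
Proof.
rewrite /bordered det_mxsub_eq0; last exact: kept_index_inj.
split=> [[v]|[x [x0 xj Al Ai]]].
  have [x ->] := vecq_surj v; rewrite vecq_eq0 Pmx1_vecq => -[x0 xj Ax].
  have keptA u : u \in kept i r -> vecq (A *m x) u 0 = 0.
    by rewrite -codom_kept_index => /codomP[w ->].
  exists x; split=> // [s sc|l li|].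
  - by rewrite -vecq_Rank xj // codom_kept_index Rank_kept eqxx.
  - by apply: coordqP => s; rewrite -vecq_Rank coordq0 keptA // Rank_kept li.
  - by rewrite -vecq_Rank keptA // Rank_kept !eqxx.
exists (vecq x); rewrite vecq_eq0 Pmx1_vecq; split=> // [v|u].
  rewrite codom_kept_index -[v]tagnat.sig2K Rank_kept negb_or negbK vecq_Rank.
  by case/andP => /eqP-> /xj.
have : kept_index i r u \in kept i r by rewrite -codom_kept_index codom_f.
rewrite -[kept_index i r u]tagnat.sig2K Rank_kept vecq_Rank.
have [-> /= /eqP->//|li _] := eqVneq (tagnat.sig1 (kept_index i r u)) i.
by rewrite Al // coordq0.
Qed.

Lemma mul_scalar_colE m (x : 'cV[quaternion R]_m) q l :
  (x *m q%:M) l 0 = x l 0 * q.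
Proof. by rewrite mxE big_ord1 mxE eqxx mulr1n. Qed.

Lemma singular_det_bordered m (A : 'M[quaternion R]_m) (i j : 'I_m)
    (r c : 'I_4) :
  \det (Pmx (triple1 R) A) = 0 -> \det (bordered A i j r c) = 0.
Proof.
move=> /det_Pmx1_eq0[y y0 Ay]; apply/det_bordered_eq0.
have [yj0|yj0] := eqVneq (y j 0) 0.
  exists y; split=> // [s _|l _|]; first by rewrite yj0 coordq0.
    by rewrite Ay mxE.
  by rewrite Ay mxE coordq0.
(* The quaternion unit of index [c]: right scaling brings the [j]-th entry of [y] to [u] without
   leaving the kernel of [A]. *)
pose u : quaternion R := quat_of (fun n => (n == c)%:R).
have u0 : u != 0.
  apply/eqP => /(congr1 (fun q => coordq q c)).
  by rewrite coordq_of coordq0 eqxx; apply/eqP/oner_neq0.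
pose x := y *m (quat_inv (y j 0) * u)%:M.
have xj : x j 0 = u by rewrite mul_scalar_colE mulrA mulqV // mul1r.
have Ax : A *m x = 0 by rewrite mulmxA Ay mul0mx.
exists x; split=> [|s sc|l _|].
- by apply: contraNneq u0 => x0; rewrite -xj x0 mxE.
- by rewrite xj coordq_of val_eqE (negPf sc).
- by rewrite Ax mxE.
- by rewrite Ax mxE coordq0.
Qed.

(** * Deleted rows and columns, and regular minors *)

Lemma delete_row_col_mul m (A : 'M[quaternion R]_m) (i j : 'I_m) (x : 'cV_m) :
  x j 0 = 0 -> delete_row_col A i j *m row' j x = row' i (A *m x).
Proof.
move=> xj; apply/matrixP => l k; rewrite (ord1 k) !mxE.
rewrite [RHS](bigD1_ord j) //= xj mulr0 add0r.
by apply: eq_bigr => n _; rewrite !mxE.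
Qed.

Lemma row'_eq0 m (j : 'I_m) (x : 'cV[quaternion R]_m) :
  x j 0 = 0 -> row' j x = 0 -> x = 0.
Proof.
move=> xj jx; apply/matrixP => l k; rewrite (ord1 k) mxE.
case: (unliftP j l) => [n ->|->//].
by have /matrixP/(_ n 0) := jx; rewrite !mxE.
Qed.

Lemma row'_surj m (j : 'I_m) (z : 'cV[quaternion R]_m.-1) :
  exists2 x : 'cV_m, x j 0 = 0 & row' j x = z.
Proof.
exists (\col_l if unlift j l is Some n then z n 0 else 0).
  by rewrite mxE unlift_none.
by apply/matrixP => l k; rewrite (ord1 k) !mxE liftK.
Qed.

(** Let [x] be the [i]-th column of the inverse of [A]; any [j] with [x j 0 != 0] works. A kernel
    vector of the minor, extended by zero at [j], is mapped by [A] to a multiple of the [i]-th basis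
    column, hence is a right multiple of [x], and its zero at [j] makes the factor vanish. *)
Lemma regular_minor m (A : 'M[quaternion R]_m) (i : 'I_m) :
  \det (Pmx (triple1 R) A) <> 0 ->
  exists j, forall z : 'cV_m.-1, delete_row_col A i j *m z = 0 -> z = 0.
Proof.
move=> detA.
have kerA (x : 'cV_m) : A *m x = 0 -> x = 0.
  have [//|x0 Ax] := eqVneq x 0.
  by case: detA; apply/det_Pmx1_eq0; exists x.
have [x Ax] : exists x : 'cV_m, A *m x = delta_mx i 0.
  have PU : Pmx (triple1 R) A \in unitmx by rewrite unitmxE unitfE; apply/eqP.
  have [x ex] := vecq_surj (invmx (Pmx (triple1 R) A) *m vecq (delta_mx i 0)).
  by exists x; apply: vecq_inj; rewrite -Pmx1_vecq -ex mulKVmx.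
have [j xj] : exists j, x j 0 != 0.
  apply/existsP; apply: contra_eqT Ax => /existsPn x0.
  have -> : x = 0.
    by apply/matrixP => l k; rewrite (ord1 k) [RHS]mxE; apply/eqP/negPn.
  rewrite mulmx0; apply/eqP => /matrixP/(_ i 0)/eqP.
  by rewrite !mxE !eqxx eq_sym oner_eq0.
exists j => z Bz; have [w wj wz] := row'_surj j z.
have Aw : A *m w = delta_mx i 0 *m ((A *m w) i 0)%:M.
  apply/matrixP => l k; rewrite (ord1 k) mul_scalar_colE [delta_mx _ _ _ _]mxE.
  case: (unliftP i l) => [n ->|->]; last by rewrite !eqxx mul1r.
  rewrite [_ == i]eq_sym (negPf (neq_lift i n)) mul0r.
  move: Bz; rewrite -wz delete_row_col_mul // => /matrixP/(_ n 0).
  by rewrite mxE [RHS]mxE.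
have wx : w = x *m ((A *m w) i 0)%:M.
  by apply: subr0_eq; apply: kerA; rewrite mulmxBr mulmxA Ax -Aw subrr.
have Awi : (A *m w) i 0 = 0.
  have := wj; rewrite wx mul_scalar_colE -wx.
  move=> /(congr1 ( *%R (quat_inv (x j 0)))).
  by rewrite mulrA mulVq // mul1r mulr0.
rewrite -wz; have -> : w = 0.
  by apply: kerA; rewrite Aw Awi raddf0 mulmx0.
by apply/matrixP => l k; rewrite !mxE.
Qed.

(** * Coordinates of the Schur complement *)

(** Right multiplication by a unit permutes coordinates up to sign, and [Cpos] is ordered so that
    each run of four positions reads the same coordinate of [s]. Here [t] counts from 0, while the
    entries of [Cpos] count from 1. *)
Lemma coordq_mul_axis (s x : quaternion R) t : (t < 16)%N -> x != 0 ->
  (forall n, (n < 4)%N -> n != (nth (1, 1)%N Cpos t).2.-1 -> coordq x n = 0) ->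
  coordq (s * x) (nth (1, 1)%N Cpos t).1.-1 = 0 -> coordq s (t %/ 4) = 0.
Proof.
case: s x => [a b c d] [a' b' c' d'] lt_t x0 H.
(* One position at a time: three of the [try] erase the off-axis coordinates of [x] and the fourth
   fails. Up to sign, there remains a coordinate of [s] times the surviving coordinate of [x]. *)
do 16! [case: t lt_t H => [|t] lt_t H /=;
  [ rewrite quatME /coordq /=;
    move: x0;
    try (have /= := H 0%N isT isT; rewrite /coordq /= => ->);
    try (have /= := H 1%N isT isT; rewrite /coordq /= => ->);
    try (have /= := H 2%N isT isT; rewrite /coordq /= => ->);
    try (have /= := H 3%N isT isT; rewrite /coordq /= => ->);
    rewrite !(mulr0, addr0, add0r, subr0, sub0r, oppr0) => x0 /eqP;
    rewrite ?oppr_eq0 mulf_eq0 => /orP[/eqP//|/eqP y0];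
    by rewrite y0 eqxx in x0 | ]].
by [].
Qed.

(** A uniqueness principle: over a regular minor, a column whose image vanishes off [i] is
    determined by its [j]-th entry. *)
Lemma minor_kernel m (A : 'M[quaternion R]_m) (i j : 'I_m) (x : 'cV_m) :
  (forall z : 'cV_m.-1, delete_row_col A i j *m z = 0 -> z = 0) ->
  x j 0 = 0 -> (forall l, l != i -> (A *m x) l 0 = 0) -> x = 0.
Proof.
move=> kerB xj Ax; apply: (row'_eq0 xj); apply: kerB.
rewrite delete_row_col_mul //; apply/matrixP => n k.
by rewrite (ord1 k) mxE Ax ?mxE // eq_sym neq_lift.
Qed.

Lemma Cpos_lt4 t :
  ((nth (1, 1) Cpos t).1.-1 < 4)%N && ((nth (1, 1) Cpos t).2.-1 < 4)%N.
Proof. by do 17?[case: t => [//|t]]. Qed.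

(* [(A *m y) i 0] is the quaternionic Schur complement of [B'] in [A]. *)
Lemma bordered_schur m (A : 'M[quaternion R]_m) (i j : 'I_m) (y : 'cV_m) t :
  (forall z : 'cV_m.-1, delete_row_col A i j *m z = 0 -> z = 0) ->
  y j 0 = 1 -> (forall l, l != i -> (A *m y) l 0 = 0) ->
  (0 < t <= 16)%N -> \det (Cmx A i j t) = 0 ->
  coordq ((A *m y) i 0) (t.-1 %/ 4) = 0.
Proof.
move=> kerB yj Ay lt_t; rewrite /Cmx.
have := Cpos_lt4 t.-1; have := @coordq_mul_axis ((A *m y) i 0) _ t.-1.
case: nth => r c /= mul_axis /andP[r4 c4] /det_bordered_eq0[x [x0 xc Ax xr]].
have xj0 : x j 0 != 0.
  by apply: contraNneq x0 => xj; apply/eqP/(minor_kernel kerB xj).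
(* Both sides have the same [j]-th entry and images vanishing off [i], so [minor_kernel] applies to
   their difference. *)
have xy : x = y *m (x j 0)%:M.
  apply/subr0_eq/(minor_kernel kerB) => [|l li].
    by rewrite mxE [X in _ + X]mxE mul_scalar_colE yj mul1r subrr.
  rewrite mulmxBr mulmxA mxE [X in _ + X]mxE mul_scalar_colE.
  by rewrite Ax // Ay // mul0r subrr.
apply: (mul_axis (x j 0)) => // [|n n4 nc|]; first by lia.
  rewrite -[n](@inordK 3) // xc //; apply: contraNneq nc => e.
  by rewrite -(@inordK 3 n) // e inordK.
by rewrite -mul_scalar_colE -mulmxA -xy -(@inordK 3 r.-1).
Qed.

Lemma det_Pmx_of_Cmx m (A : 'M[quaternion R]_m) (i j : 'I_m) t1 t2 t3 t4 :
  (forall z : 'cV_m.-1, delete_row_col A i j *m z = 0 -> z = 0) ->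
  [/\ (1 <= t1 <= 4)%N, (5 <= t2 <= 8)%N,
      (9 <= t3 <= 12)%N & (13 <= t4 <= 16)%N] ->
  [/\ \det (Cmx A i j t1) = 0, \det (Cmx A i j t2) = 0,
      \det (Cmx A i j t3) = 0 & \det (Cmx A i j t4) = 0] ->
  \det (Pmx (triple1 R) A) = 0.
Proof.
move=> kerB [lt1 lt2 lt3 lt4] [d1 d2 d3 d4].
have [y yj Ay] : exists2 y : 'cV_m, y j 0 = 1 &
    forall l, l != i -> (A *m y) l 0 = 0.
  (* Singularity of the first matrix alone supplies [x]; dividing by its [j]-th entry on the right
     then gives [y]. *)
  have [x [x0 Ax]] : exists x : 'cV_m, x != 0 /\
      forall l, l != i -> (A *m x) l 0 = 0.
    move: d1; rewrite /Cmx; case: nth => r c /det_bordered_eq0[x [x0 _ Ax _]].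
    by exists x.
  have xj0 : x j 0 != 0.
    by apply: contraNneq x0 => xj; apply/eqP/(minor_kernel kerB xj).
  exists (x *m (quat_inv (x j 0))%:M) => [|l li].
    by rewrite mul_scalar_colE mulqV.
  by rewrite mulmxA mul_scalar_colE Ax // mul0r.
apply/det_Pmx1_eq0; exists y.
  apply/eqP => y0; move: yj; rewrite y0 mxE => /eqP.
  by rewrite eq_sym oner_eq0.
have s t : (0 < t <= 16)%N -> \det (Cmx A i j t) = 0 ->
  coordq ((A *m y) i 0) (t.-1 %/ 4) = 0 by exact: bordered_schur.
have Ayi : (A *m y) i 0 = 0.
  (* The four groups of indices correspond to the four coordinates of [(A *m y) i 0]. *)
  have q4 t k : (4 * k < t <= 4 * k + 4)%N -> (t.-1 %/ 4 = k)%N by lia.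
  apply: quatP.
  - by have := s t1 _ d1; rewrite (q4 _ 0%N) //; apply; lia.
  - by have := s t2 _ d2; rewrite (q4 _ 1%N) //; apply; lia.
  - by have := s t3 _ d3; rewrite (q4 _ 2%N) //; apply; lia.
  - by have := s t4 _ d4; rewrite (q4 _ 3%N) //; apply; lia.
apply/matrixP => l k; rewrite (ord1 k) [RHS]mxE.
by have [->|/Ay] := eqVneq l i.
Qed.

End Bordered.

(** * Equivalence of the three conditions for an arbitrary Hamiltonian triple *)

Theorem theorem2p7 (R : realType) (T : 'I_48 -> triple R)
    (hT : hamiltonian_enumeration T) (m : nat) (hm : (1 < m)%N)
    (A : 'M[quaternion R]_m) (k : 'I_48) (B' : 'M[quaternion R]_m.-1)
    (i j : 'I_m) (hB' : B' = delete_row_col A i j)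
    (hmax : \rank (Pmx (triple1 R) B') =
       (\max_(p : 'I_m * 'I_m) \rank (Pmx (triple1 R) (delete_row_col A p.1 p.2)))%N) :
  [<-> \det (Pmx (T k) A) = 0;
       exists t1 t2 t3 t4 : nat,
         [/\ (1 <= t1 <= 4)%N, (5 <= t2 <= 8)%N,
             (9 <= t3 <= 12)%N & (13 <= t4 <= 16)%N] /\
         [/\ \det (Cmx A i j t1) = 0, \det (Cmx A i j t2) = 0,
             \det (Cmx A i j t3) = 0 & \det (Cmx A i j t4) = 0];
       forall t1 t2 t3 t4 : nat,
         [/\ (1 <= t1 <= 4)%N, (5 <= t2 <= 8)%N,
             (9 <= t3 <= 12)%N & (13 <= t4 <= 16)%N] ->
         [/\ \det (Cmx A i j t1) = 0, \det (Cmx A i j t2) = 0,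
             \det (Cmx A i j t3) = 0 & \det (Cmx A i j t4) = 0]].
Proof.
have hTk : hamiltonian_triple (T k) by case: hT => _ hTE _; apply/hTE; exists k.
(* Every natural [t] is covered: outside the range 1 to 16, [Cmx] falls back on M(1,1). *)
have det1_C : \det (Pmx (triple1 R) A) = 0 -> forall t, \det (Cmx A i j t) = 0.
  by move=> detA t; rewrite /Cmx; case: nth => r c;
    apply: singular_det_bordered.
have C_det1 t1 t2 t3 t4 :
    [/\ (1 <= t1 <= 4)%N, (5 <= t2 <= 8)%N,
        (9 <= t3 <= 12)%N & (13 <= t4 <= 16)%N] ->
    [/\ \det (Cmx A i j t1) = 0, \det (Cmx A i j t2) = 0,
        \det (Cmx A i j t3) = 0 & \det (Cmx A i j t4) = 0] ->
    \det (Pmx (triple1 R) A) = 0.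
  move=> lt_t dC; have [//|/eqP detA] := eqVneq (\det (Pmx (triple1 R) A)) 0.
  (* A regular minor exists with the same deleted row [i]; its full rank bounds the maximum from
     below, so [B'] has full rank too. *)
  have [j' kerB] := regular_minor i detA.
  apply: (det_Pmx_of_Cmx _ lt_t dC).
  rewrite -hB'; apply/rank_Pmx1_full/eqP; rewrite eqn_leq rank_leq_row hmax.
  apply: leq_trans (leq_bigmax (i, j')).
  by rewrite (proj2 (rank_Pmx1_full _) kerB).
tfae.
- move/(det_Pmx_eq0 hTk)/det1_C => dC.
  (* The first index of each group serves as witness. *)
  by exists 1%N, 5, 9, 13; split; split.
- by case=> t1 [t2 [t3 [t4 [lt_t dC]]]] u1 u2 u3 u4 _; split;
    apply/det1_C/(C_det1 t1 t2 t3 t4).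
- move=> dC; apply/(det_Pmx_eq0 hTk)/(C_det1 1%N 5 9 13); first by split.
  by apply: dC; split.
Qed.
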